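(* Let $\phi\in\mathscr{L}_{{\sim_\mathsf{i}},\Box,\lozenge}(2)$, $\chi\in\mathscr{L}^{\mathsf{bl}}_{\Box,\blacksquare}$, and let $\Box_1,\lozenge_1$ and $\Box_2,\lozenge_2$ be associated with $R^+$ and $R^-$, respectively. Then, for every bi-relational pointed frame $\langle\mathfrak{F},w\rangle=\langle\langle W,R^+,R^-\rangle,w\rangle$: \begin{enumerate} \item $\mathfrak{F},w\models_{\mathbf{K}\mathsf{G}_{\mathsf{inv}}}\phi$ iff $\mathfrak{F},w\models_{\mathbf{K}\mathsf{G}_{\mathsf{bl}}}\mathbf{B}\rightarrow\phi^{\Join}$; \item $\mathfrak{F},w\models_{\mathbf{K}\mathsf{G}_{\mathsf{bl}}}\chi$ iff $\mathfrak{F},w\models_{\mathbf{K}\mathsf{G}_{\mathsf{inv}}(2)}\chi^\oplus\wedge{\sim}(\chi^\ominus)$. \end{enumerate}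
   Context: $\mathbf{K}\mathsf{G}_{\mathsf{inv}}(2)$ is G\''odel modal logic with involutive negation (${\sim_\mathsf{i}}$, $\wedge$, G\''odel $\rightarrow$, with $v({\sim_\mathsf{i}}\phi,w)=1-v(\phi,w)$) over bi-relational frames $\langle W,R^+,R^-\rangle$ ($R^\pm:W\times W\to[0,1]$) with modalities $\Box_k\phi$ (value $\inf_{w'}\{wR w'\rightarrow v(\phi,w')\}$) and $\lozenge_k\phi$ (value $\sup_{w'}\min(wRw',v(\phi,w'))$), where $R=R^+$ for $k=1$ and $R=R^-$ for $k=2$; $\vee$ is ${\sim_\mathsf{i}}({\sim_\mathsf{i}}\phi\wedge{\sim_\mathsf{i}}\chi)$, ${\sim}\phi=\phi\rightarrow\mathbf{0}$, $\mathbf{0}={\sim_\mathsf{i}}(p\rightarrow p)$. $\mathbf{K}\mathsf{G}_{\mathsf{bl}}$ has language $p\mid\neg\phi\mid\phi\wedge\phi\mid\phi\rightarrow\phi\mid\Box\phi\mid\lozenge\phi\mid-\phi\mid\phi\sqcap\phi\mid\phi\sqsupset\phi\mid\blacksquare\phi\mid\lozenge^{\bullet}\phi$ (where $\lozenge^{\bullet}$ is the informational diamond), models $\langle W,R^+,R^-,v_1,v_2\rangle$, and ($i\neq j$): $v_i(\neg\phi)=v_j(\phi)$; $v_i(-\phi)=1-v_j(\phi)$; $v_1$ of $\wedge,\sqcap$ is $\min$; $v_2(\phi\wedge\chi)=\max$, $v_2(\phi\sqcap\chi)=\min$; $v_1(\phi\rightarrow\chi)=v_1(\phi\sqsupset\chi)=1$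 if $v_1(\phi)\le v_1(\chi)$ else $v_1(\chi)$; $v_2(\phi\rightarrow\chi)=0$ if $v_2(\chi)\le v_2(\phi)$ else $v_2(\chi)$; $v_2(\phi\sqsupset\chi)=1$ if $v_2(\phi)\le v_2(\chi)$ else $v_2(\chi)$; $v_1(\Box\phi)=v_1(\blacksquare\phi)=\inf\{wR^+w'\rightarrow v_1(\phi,w')\}$; $v_1(\lozenge\phi)=v_1(\lozenge^\bullet\phi)=\sup\min(wR^+w',v_1(\phi,w'))$; $v_2(\Box\phi)=v_2(\lozenge^\bullet\phi)=\sup\min(wR^-w',v_2(\phi,w'))$; $v_2(\lozenge\phi)=v_2(\blacksquare\phi)=\inf\{wR^-w'\rightarrow v_2(\phi,w')\}$. $\mathbf{B}:=p\sqsupset p$ has value $(1,1)$. $\mathfrak{F},w\models_{\mathbf{K}\mathsf{G}_{\mathsf{bl}}}\chi$ (strong validity) means $v_1(\chi,w)=1$ and $v_2(\chi,w)=0$ in every model on $\mathfrak{F}$. Translations (fresh $p^*$ per $p$): $p^\oplus=p$, $p^\ominus=p^*$; $(\neg\phi)^\oplus=\phi^\ominus$, $(\neg\phi)^\ominus=\phi^\oplus$; $(-\phi)^\oplus={\sim_\mathsf{i}}\phi^\ominus$, $(-\phi)^\ominus={\sim_\mathsf{i}}\phi^\oplus$; $(\phi\wedge\chi)^\oplus=(\phi\sqcap\chi)^\oplus=\phi^\oplus\wedge\chi^\oplus$; $(\phi\wedge\chi)^\ominus=\phi^\ominus\vee\chi^\ominus$; $(\phi\sqcap\chi)^\ominus=\phi^\ominus\wedge\chi^\ominus$;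 $(\phi\rightarrow\chi)^\oplus=(\phi\sqsupset\chi)^\oplus=\phi^\oplus\rightarrow\chi^\oplus$; $(\phi\rightarrow\chi)^\ominus={\sim_\mathsf{i}}({\sim_\mathsf{i}}\phi^\ominus\rightarrow{\sim_\mathsf{i}}\chi^\ominus)$ (co-implication of $\chi^\ominus$ by $\phi^\ominus$); $(\phi\sqsupset\chi)^\ominus=\phi^\ominus\rightarrow\chi^\ominus$; $(\Box\phi)^\oplus=(\blacksquare\phi)^\oplus=\Box_1\phi^\oplus$; $(\lozenge\phi)^\oplus=(\lozenge^\bullet\phi)^\oplus=\lozenge_1\phi^\oplus$; $(\Box\phi)^\ominus=(\lozenge^\bullet\phi)^\ominus=\lozenge_2\phi^\ominus$; $(\lozenge\phi)^\ominus=(\blacksquare\phi)^\ominus=\Box_2\phi^\ominus$. For $\phi\in\mathscr{L}_{{\sim_\mathsf{i}},\Box,\lozenge}(2)$, $\phi^{\Join}$ replaces $\Box_1,\lozenge_1$ by $\Box,\lozenge$, $\Box_2$ by $\neg\lozenge\neg$ and $\lozenge_2$ by $\neg\Box\neg$. *)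

(* Defs.v *)
From mathcomp Require Import all_boot all_order all_algebra.
From mathcomp Require Import classical_sets reals.
Set Implicit Arguments.
Unset Strict Implicit.
Unset Printing Implicit Defensive.
Import Order.TTheory GRing.Theory Num.Theory.
Local Open Scope ring_scope.
Local Open Scope classical_set_scope.

(* [FInv] is the involutive negation; [FBox1], [FDia1] go with R^+ and
   [FBox2], [FDia2] with R^-. *)
Inductive inv_form (V : Type) : Type :=
  | FVar of V
  | FInv of inv_form V
  | FAnd of inv_form V & inv_form V
  | FImp of inv_form V & inv_form V
  | FBox1 of inv_form V
  | FDia1 of inv_form V
  | FBox2 of inv_form V
  | FDia2 of inv_form V.

Definition FOr (V : Type) (phi chi : inv_form V) : inv_form V :=
  FInv (FAnd (FInv phi) (FInv chi)).

(* The constant 0 is an abbreviation depending on the choice of a variable. *)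
Definition FZero (V : Type) (p : V) : inv_form V :=
  FInv (FImp (FVar p) (FVar p)).

Definition FNot (V : Type) (p : V) (phi : inv_form V) : inv_form V :=
  FImp phi (FZero p).

(* [BNeg] is the negation swapping v_1 and v_2, [BConf] is
   the conflation -, [BIAnd] is the square conjunction, [BIImp] the square
   implication, [BIBox] the black box, [BIDia] the bulleted diamond. *)
Inductive bl_form (V : Type) : Type :=
  | BVar of V
  | BNeg of bl_form V
  | BAnd of bl_form V & bl_form V
  | BImp of bl_form V & bl_form V
  | BBox of bl_form V
  | BDia of bl_form V
  | BConf of bl_form V
  | BIAnd of bl_form V & bl_form V
  | BIImp of bl_form V & bl_form V
  | BIBox of bl_form V
  | BIDia of bl_form V.

(* The constant with value (1, 1). *)
Definition BBoth (V : Type) (p : V) : bl_form V := BIImp (BVar p) (BVar p).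

Record frame (R : realType) : Type := Frame {
  world :> Type;
  relp : world -> world -> R;
  relm : world -> world -> R;
  relp_unit : forall w w', 0 <= relp w w' <= 1;
  relm_unit : forall w w', 0 <= relm w w' <= 1
}.

Definition is_valuation (R : realType) (V W : Type) (v : V -> W -> R) : Prop :=
  forall p w, 0 <= v p w <= 1.

Definition godel_imp (R : realType) (a b : R) : R := if a <= b then 1 else b.

(* Co-implication of [b] by [a], the dual of [godel_imp a b]. *)
Definition godel_coimp (R : realType) (a b : R) : R :=
  if b <= a then 0 else b.

(* A frame with a point w is nonempty and all values are in [0, 1], so these
   [inf] and [sup] are those of nonempty bounded sets. *)
Definition box_val (R : realType) (W : Type) (r : W -> W -> R) (f : W -> R)
    (w : W) : R :=
  inf (range (fun w' => godel_imp (r w w') (f w'))).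

Definition dia_val (R : realType) (W : Type) (r : W -> W -> R) (f : W -> R)
    (w : W) : R :=
  sup (range (fun w' => Num.min (r w w') (f w'))).

Fixpoint inv_val (R : realType) (V : Type) (F : frame R) (v : V -> F -> R)
    (phi : inv_form V) : F -> R :=
  match phi with
  | FVar p => v p
  | FInv a => fun w => 1 - inv_val v a w
  | FAnd a b => fun w => Num.min (inv_val v a w) (inv_val v b w)
  | FImp a b => fun w => godel_imp (inv_val v a w) (inv_val v b w)
  | FBox1 a => box_val (@relp R F) (inv_val v a)
  | FDia1 a => dia_val (@relp R F) (inv_val v a)
  | FBox2 a => box_val (@relm R F) (inv_val v a)
  | FDia2 a => dia_val (@relm R F) (inv_val v a)
  end.

Definition inv_valid (R : realType) (V : Type) (F : frame R) (w : F)
    (phi : inv_form V) : Prop :=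
  forall v : V -> F -> R, is_valuation v -> inv_val v phi w = 1.

Fixpoint bl_val1 (R : realType) (V : Type) (F : frame R) (v1 v2 : V -> F -> R)
    (phi : bl_form V) {struct phi} : F -> R :=
  match phi with
  | BVar p => v1 p
  | BNeg a => bl_val2 v1 v2 a
  | BConf a => fun w => 1 - bl_val2 v1 v2 a w
  | BAnd a b | BIAnd a b =>
      fun w => Num.min (bl_val1 v1 v2 a w) (bl_val1 v1 v2 b w)
  | BImp a b | BIImp a b =>
      fun w => godel_imp (bl_val1 v1 v2 a w) (bl_val1 v1 v2 b w)
  | BBox a | BIBox a => box_val (@relp R F) (bl_val1 v1 v2 a)
  | BDia a | BIDia a => dia_val (@relp R F) (bl_val1 v1 v2 a)
  end
with bl_val2 (R : realType) (V : Type) (F : frame R) (v1 v2 : V -> F -> R)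
    (phi : bl_form V) {struct phi} : F -> R :=
  match phi with
  | BVar p => v2 p
  | BNeg a => bl_val1 v1 v2 a
  | BConf a => fun w => 1 - bl_val1 v1 v2 a w
  | BAnd a b => fun w => Num.max (bl_val2 v1 v2 a w) (bl_val2 v1 v2 b w)
  | BIAnd a b => fun w => Num.min (bl_val2 v1 v2 a w) (bl_val2 v1 v2 b w)
  | BImp a b => fun w => godel_coimp (bl_val2 v1 v2 a w) (bl_val2 v1 v2 b w)
  | BIImp a b => fun w => godel_imp (bl_val2 v1 v2 a w) (bl_val2 v1 v2 b w)
  | BBox a | BIDia a => dia_val (@relm R F) (bl_val2 v1 v2 a)
  | BDia a | BIBox a => box_val (@relm R F) (bl_val2 v1 v2 a)
  end.

Definition bl_valid (R : realType) (V : Type) (F : frame R) (w : F)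
    (phi : bl_form V) : Prop :=
  forall v1 v2 : V -> F -> R, is_valuation v1 -> is_valuation v2 ->
    bl_val1 v1 v2 phi w = 1 /\ bl_val2 v1 v2 phi w = 0.

(* [pos_tr] and [neg_tr] are the translations written with superscripts
   (+) and (-). The variables of the target are [inl p] for p and [inr p] for
   the fresh p^*. *)
Fixpoint pos_tr (V : Type) (phi : bl_form V) {struct phi} : inv_form (V + V) :=
  match phi with
  | BVar p => FVar (inl p)
  | BNeg a => neg_tr a
  | BConf a => FInv (neg_tr a)
  | BAnd a b | BIAnd a b => FAnd (pos_tr a) (pos_tr b)
  | BImp a b | BIImp a b => FImp (pos_tr a) (pos_tr b)
  | BBox a | BIBox a => FBox1 (pos_tr a)
  | BDia a | BIDia a => FDia1 (pos_tr a)
  end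
with neg_tr (V : Type) (phi : bl_form V) {struct phi} : inv_form (V + V) :=
  match phi with
  | BVar p => FVar (inr p)
  | BNeg a => pos_tr a
  | BConf a => FInv (pos_tr a)
  | BAnd a b => FOr (neg_tr a) (neg_tr b)
  | BIAnd a b => FAnd (neg_tr a) (neg_tr b)
  | BImp a b => FInv (FImp (FInv (neg_tr a)) (FInv (neg_tr b)))
  | BIImp a b => FImp (neg_tr a) (neg_tr b)
  | BBox a | BIDia a => FDia2 (neg_tr a)
  | BDia a | BIBox a => FBox2 (neg_tr a)
  end.

(* The involutive negation is not primitive in [bl_form]; it is the composite
   of [BNeg] and [BConf], with v_i (BNeg (BConf a)) = 1 - v_i a for i = 1, 2. *)
Fixpoint join_tr (V : Type) (phi : inv_form V) : bl_form V :=
  match phi with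
  | FVar p => BVar p
  | FInv a => BNeg (BConf (join_tr a))
  | FAnd a b => BAnd (join_tr a) (join_tr b)
  | FImp a b => BImp (join_tr a) (join_tr b)
  | FBox1 a => BBox (join_tr a)
  | FDia1 a => BDia (join_tr a)
  | FBox2 a => BNeg (BDia (BNeg (join_tr a)))
  | FDia2 a => BNeg (BBox (BNeg (join_tr a)))
  end.

(* Main.v *)
(** The translations commute with the semantics.  In [join_tr phi] the value
    [v_1] never depends on [v_2] and is the value of [phi]; prefixing
    [BBoth p] with value (1, 1) makes [v_2] trivially 0, so only [v_1 = 1]
    remains.  Dually, a pair (v_1, v_2) is the same thing as one valuation on
    [V + V], under which [pos_tr chi] and [neg_tr chi] compute [v_1] and [v_2]
    of [chi]. *)

Require Import Defs.
From mathcomp Require Import all_boot all_order all_algebra.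
From mathcomp Require Import classical_sets reals.
From mathcomp Require Import lra.

Set Implicit Arguments.
Unset Strict Implicit.
Unset Printing Implicit Defensive.
Import Order.TTheory GRing.Theory Num.Theory.
Local Open Scope ring_scope.
Local Open Scope classical_set_scope.

Lemma min_eq1 (R : realType) (a b : R) : a <= 1 -> b <= 1 ->
  Num.min a b = 1 <-> a = 1 /\ b = 1.
Proof.
move=> a1 b1; split=> [m1|[-> ->]]; last by rewrite minxx.
have : (1 <= a) && (1 <= b) by rewrite -le_min m1.
by case/andP=> ha hb; split; apply/le_anti/andP.
Qed.

Lemma godel_imp_unit (R : realType) (a b : R) :
  0 <= b <= 1 -> 0 <= godel_imp a b <= 1.
Proof. by rewrite /godel_imp; case: ifP => // _ _; rewrite ler01 lexx. Qed.

Lemma min_unit (R : realType) (a b : R) :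
  0 <= a <= 1 -> 0 <= b <= 1 -> 0 <= Num.min a b <= 1.
Proof. by move=> ha hb; rewrite /Num.min; case: ifP. Qed.

Lemma godel_imp_id (R : realType) (a : R) : godel_imp a a = 1.
Proof. by rewrite /godel_imp lexx. Qed.

Lemma godel_imp1 (R : realType) (a : R) : a <= 1 -> godel_imp 1 a = a.
Proof.
by rewrite /godel_imp => a1; case: ifP => // h; apply/le_anti; rewrite h a1.
Qed.

Lemma godel_coimp1 (R : realType) (a : R) : a <= 1 -> godel_coimp 1 a = 0.
Proof. by rewrite /godel_coimp => ->. Qed.

Lemma godel_imp0_eq1 (R : realType) (a : R) : 0 <= a ->
  godel_imp a 0 = 1 <-> a = 0.
Proof.
move=> a0; rewrite /godel_imp; split=> [|->]; last by rewrite lexx.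
case: ifP => [h _|_ /eqP]; first by apply/le_anti; rewrite h a0.
by rewrite eq_sym oner_eq0.
Qed.

(** The involution reverses the order, so it carries the Gödel implication to its dual. This settles
    the [BImp] clause of [neg_tr], as [inv_min_inv] settles the [BAnd] clause. *)
Lemma inv_godel_imp_inv (R : realType) (a b : R) :
  1 - godel_imp (1 - a) (1 - b) = godel_coimp a b.
Proof.
rewrite /godel_imp /godel_coimp lerD2l lerN2.
by case: ifP => _; rewrite ?subrr // subKr.
Qed.

Lemma inv_min_inv (R : realType) (a b : R) :
  1 - Num.min (1 - a) (1 - b) = Num.max a b.
Proof. by rewrite -addr_minr -oppr_max opprD opprK addNKr. Qed.

Section UnitInterval.
Context {R : realType} {W : Type}.
Variables (f : W -> R) (w : W).
Hypothesis f01 : forall x, 0 <= f x <= 1.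

(** Here and in [sup_range_unit], the point [w] makes the range nonempty, and one of the two bounds
    comes from comparison with the value [f w]. *)
Lemma inf_range_unit : 0 <= inf (range f) <= 1.
Proof.
have lb0 : lbound (range f) 0 by move=> _ [x _ <-]; case/andP: (f01 x).
apply/andP; split; first by apply: lb_le_inf => //; exists (f w), w.
have [_ fw1] := andP (f01 w).
by apply: le_trans fw1; apply: ge_inf; [exists 0 | exists w].
Qed.

Lemma sup_range_unit : 0 <= sup (range f) <= 1.
Proof.
have ub1 : ubound (range f) 1 by move=> _ [x _ <-]; case/andP: (f01 x).
apply/andP; split; last by apply: ge_sup => //; exists (f w), w.
have [fw0 _] := andP (f01 w).
by apply: le_trans fw0 _; apply: ub_le_sup; [exists 1 | exists w].
Qed.

End UnitInterval.

Lemma inv_val_unit (R : realType) (V : Type) (F : frame R) (v : V -> F -> R)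
    (phi : inv_form V) (w : F) :
  is_valuation v -> 0 <= inv_val v phi w <= 1.
Proof.
move=> v01; elim: phi w => [q|a IH|a IHa b IHb|a IHa b IHb|a IH|a IH|a IH|a IH]
  w /=; first exact: v01.
- by have := IH w; lra.
- exact: min_unit.
- exact: godel_imp_unit.
- by apply: inf_range_unit => // x; apply: godel_imp_unit.
- by apply: sup_range_unit => // x; apply: min_unit => //; apply: relp_unit.
- by apply: inf_range_unit => // x; apply: godel_imp_unit.
- by apply: sup_range_unit => // x; apply: min_unit => //; apply: relm_unit.
Qed.

(** Each detour through [v2] is undone at once: [BNeg] and [BConf] both swap the coordinates, and in
    [FBox2] and [FDia2] the outer [BNeg] moves to [v2], where the modality reads [relm], while the
    inner one returns to [v1]. *)
Lemma join_tr_val1 (R : realType) (V : Type) (F : frame R)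
    (v1 v2 : V -> F -> R) (phi : inv_form V) :
  bl_val1 v1 v2 (join_tr phi) = inv_val v1 phi.
Proof.
by elim: phi => [q|a IH|a IHa b IHb|a IHa b IHb|a IH|a IH|a IH|a IH] //=;
  rewrite ?IHa ?IHb ?IH.
Qed.

Section PairTranslation.
Context {R : realType} {V : Type} {F : frame R}.
Variable v : V + V -> F -> R.

Let v1 q := v (inl q).
Let v2 q := v (inr q).

(** Both equalities go through one induction because [BNeg] and [BConf] exchange the coordinates. *)
Lemma pos_neg_tr_val (chi : bl_form V) :
  inv_val v (pos_tr chi) =1 bl_val1 v1 v2 chi /\
  inv_val v (neg_tr chi) =1 bl_val2 v1 v2 chi.
Proof.
(* The induction hypotheses are only pointwise, so the modal clauses need congruence under [=1]. *)
have box r (f g : F -> R) : f =1 g -> box_val r f =1 box_val r g.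
  move=> fg x; rewrite /box_val; congr inf.
  by apply: eq_imagel => y _; rewrite fg.
have dia r (f g : F -> R) : f =1 g -> dia_val r f =1 dia_val r g.
  move=> fg x; rewrite /dia_val; congr sup.
  by apply: eq_imagel => y _; rewrite fg.
elim: chi => [q|a [p1 p2]|a [p1 p2] b [q1 q2]|a [p1 p2] b [q1 q2]|a [p1 p2]
  |a [p1 p2]|a [p1 p2]|a [p1 p2] b [q1 q2]|a [p1 p2] b [q1 q2]
  |a [p1 p2]|a [p1 p2]]; split=> x //=; rewrite -?p1 -?p2 -?q1 -?q2 //;
  by [exact: inv_min_inv | exact: inv_godel_imp_inv | exact: box | exact: dia].
Qed.

End PairTranslation.

(** The bounds are inherited from [inv_val_unit] by gluing the pair into one valuation on
    [V + V]. *)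
Lemma bl_val_unit (R : realType) (V : Type) (F : frame R)
    (v1 v2 : V -> F -> R) (chi : bl_form V) (w : F) :
  is_valuation v1 -> is_valuation v2 ->
  0 <= bl_val1 v1 v2 chi w <= 1 /\ 0 <= bl_val2 v1 v2 chi w <= 1.
Proof.
move=> v101 v201.
pose v (s : V + V) := match s with inl q => v1 q | inr q => v2 q end.
have v01 : is_valuation v by case=> q; [exact: v101 | exact: v201].
have [eq1 eq2] := pos_neg_tr_val v chi.
by split; [rewrite -[bl_val1 _ _ _ _]eq1 | rewrite -[bl_val2 _ _ _ _]eq2];
  apply: inv_val_unit.
Qed.

(** On values at most 1, [godel_imp 1] is the identity and [godel_coimp 1] is constantly 0. *)
Lemma BBoth_imp_val (R : realType) (V : Type) (p : V) (F : frame R)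
    (v1 v2 : V -> F -> R) (chi : bl_form V) (w : F) :
  is_valuation v1 -> is_valuation v2 ->
  bl_val1 v1 v2 (BImp (BBoth p) chi) w = bl_val1 v1 v2 chi w /\
  bl_val2 v1 v2 (BImp (BBoth p) chi) w = 0.
Proof.
move=> v101 v201; have [/andP[_ le1] /andP[_ le2]] := bl_val_unit chi w v101 v201.
by rewrite /= !godel_imp_id godel_imp1 // godel_coimp1.
Qed.

Lemma inv_val_and_not_eq1 (R : realType) (V : Type) (p : V) (F : frame R)
    (v : V -> F -> R) (phi psi : inv_form V) (w : F) : is_valuation v ->
  inv_val v (FAnd phi (FNot p psi)) w = 1 <->
  inv_val v phi w = 1 /\ inv_val v psi w = 0.
Proof.
move=> v01; have /andP[_ phi1] := inv_val_unit phi w v01.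
have /andP[_ not1] := inv_val_unit (FNot p psi) w v01.
have /andP[psi0 _] := inv_val_unit psi w v01.
(* [FZero p] evaluates to 1 - 1 = 0, and the Gödel negation of a nonnegative value is 1 only at
   0. *)
rewrite (min_eq1 phi1 not1) /= godel_imp_id subrr.
by rewrite (godel_imp0_eq1 psi0).
Qed.

Theorem theorem3 (R : realType) (V : Type) (p : V)
    (phi : inv_form V) (chi : bl_form V) (F : frame R) (w : F) :
  (inv_valid w phi <-> bl_valid w (BImp (BBoth p) (join_tr phi))) /\
  (bl_valid w chi <->
   inv_valid w (FAnd (pos_tr chi) (FNot (inl p) (neg_tr chi)))).
Proof.
split; split.
- move=> valid v1 v2 v101 v201.
  have [-> ->] := BBoth_imp_val p (join_tr phi) w v101 v201.
  by rewrite join_tr_val1 valid.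
(* Any second valuation would do, since only the first coordinate is read; [v] itself is at hand. *)
- move=> valid v v01; have [+ _] := valid v v v01 v01.
  have [-> _] := BBoth_imp_val p (join_tr phi) w v01 v01.
  by rewrite join_tr_val1.
- move=> valid v v01; apply/inv_val_and_not_eq1 => //.
  have [-> ->] := pos_neg_tr_val v chi.
  by apply: valid => q x; apply: v01.
- move=> valid v1 v2 v101 v201.
  pose v (s : V + V) := match s with inl q => v1 q | inr q => v2 q end.
  have v01 : is_valuation v by case=> q; [exact: v101 | exact: v201].
  have [eq1 eq2] := pos_neg_tr_val v chi.
  have /inv_val_and_not_eq1 -/(_ v01) := valid v v01.
  by rewrite eq1 eq2.
Qed.
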